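(* For every finite simple graph $G$, with oriented incidence matrix $D$ with respect to a fixed orientation, $$\ell(\mathcal A(G))=\frac14\sum_{v\in V(G)}d(v)^2-\frac14\max_{x\in\{\pm1\}^{E(G)}}\|Dx\|^2 .$$ Equivalently, if $M(G):=\max_{x\in\{\pm1\}^{E(G)}}\|Dx\|^2$, then $\ell(\mathcal A(G))=\frac14\sum_{v\in V(G)}d(v)^2-\frac14M(G)$.
   Context: Here $d(v)$ is the degree of $v$ and $\|\cdot\|$ is the Euclidean norm. Fix an orientation of the edges of $G=(V,E)$; the oriented incidence matrix $D$ is the $|V|\times|E|$ matrix with $D_{ve}=+1$ if $v$ is the head of $e$, $-1$ if $v$ is the tail of $e$, and $0$ otherwise. The antisymmetric line graph $\mathcal A(G)$ is the signed graph with vertex set $E(G)$ and signed adjacency matrix $D^{\mathsf T}D-2I$ (nonzero entries are edges, with the entry $\pm1$ as sign). Switching a signed graph at a vertex reverses the signs of all edges incident to it; changing the orientation changes $\mathcal A(G)$ only by switching. The sign of a cycle is the product of its edge signs, and a signed graph is balanced if all its cycles are positive. The frustration index $\ell(\Sigma)$ of a signed graph $\Sigma$ is the minimum number of edges whose deletion makes $\Sigma$ balanced (equivalently, the minimum number of negative edges among all switchings of $\Sigma$); it is switching invariant. *)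

(* Defs.v *)
From HB Require Import structures.
From mathcomp Require Import all_boot all_order all_algebra.

Set Implicit Arguments.
Unset Strict Implicit.
Unset Printing Implicit Defensive.

Import Order.TTheory GRing.Theory Num.Theory.
Local Open Scope ring_scope.

Record sgraph := SGraph {
  vert :> finType;
  adj : rel vert;
  adj_sym : symmetric adj;
  adj_irr : irreflexive adj }.

Definition degree (G : sgraph) (v : G) : nat := #|[set u | adj v u]|.

Definition edges (G : sgraph) : {set {set G}} :=
  [set A | [exists x : G, exists y : G, adj x y && (A == [set x; y])]].

Definition edge (G : sgraph) : finType := {A : {set G} | A \in edges G}.

Record orientation (G : sgraph) := Orientation {
  head : edge G -> G;
  tail : edge G -> G;
  head_tail : forall e : edge G, val e = [set head e; tail e] }.

(* Rows are indexed by V(G) and columns by E(G), through their canonical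
   enumerations. *)
Definition incidence_mx (R : pzRingType) (G : sgraph) (o : orientation G) :
    'M[R]_(#|G|, #|edge G|) :=
  \matrix_(v, e) (if enum_val v == head o (enum_val e) then 1
                  else if enum_val v == tail o (enum_val e) then -1
                  else 0).

(* A signed graph on 'I_m, given by its signed adjacency matrix: nonzero entries
   are edges, with the entry as sign. *)
Record signed_graph (m : nat) := SignedGraph {
  sadj : 'M[int]_m;
  sadj_sym : sadj^T = sadj;
  sadj_diag : forall i, sadj i i = 0;
  sadj_sign : forall i j, sadj i j \in [:: -1; 0; 1] }.

Section SignedGraph.
Variables (m : nat) (S : signed_graph m).

Definition sedges : {set {set 'I_m}} :=
  [set A | [exists i, exists j, (sadj S i j != 0) && (A == [set i; j])]].

Definition is_cycle (c : seq 'I_m) : bool :=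
  [&& 2 < size c, uniq c & cycle (fun i j => sadj S i j != 0) c]%N.

Definition cycle_sign (c : seq 'I_m) : int :=
  \prod_(i <- c) sadj S i (next c i).

(* Cycles have no repeated vertex, so bounding their length by m loses nothing;
   see balancedP. *)
Definition balanced : bool :=
  [forall k : 'I_m.+1, forall c : k.-tuple 'I_m,
     is_cycle c ==> (cycle_sign c == 1)].

Lemma balancedP :
  reflect (forall c, is_cycle c -> cycle_sign c = 1) balanced.
Proof.
apply: (iffP idP) => [/forallP bal c cP | bal].
  have c_le : (size c < m.+1)%N.
    case/and3P: (cP) => _ /card_uniqP <- _.
    by rewrite ltnS -[X in (_ <= X)%N]card_ord max_card.
  have /forallP/(_ (in_tuple c))/implyP/(_ cP)/eqP := bal (Ordinal c_le).
  by [].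
apply/forallP => k; apply/forallP => c; apply/implyP => cP.
by rewrite bal.
Qed.

Definition delete_mx (F : {set {set 'I_m}}) : 'M[int]_m :=
  \matrix_(i, j) (if [set i; j] \in F then 0 else sadj S i j).

Fact delete_sym F : (delete_mx F)^T = delete_mx F.
Proof.
apply/matrixP => i j; rewrite !mxE setUC.
by rewrite -[in LHS]sadj_sym mxE.
Qed.

Fact delete_diag F i : delete_mx F i i = 0.
Proof. by rewrite mxE sadj_diag if_same. Qed.

Fact delete_sign F i j : delete_mx F i j \in [:: -1; 0; 1].
Proof. by rewrite mxE; case: ifP => _; rewrite ?sadj_sign. Qed.

Definition delete_edges (F : {set {set 'I_m}}) : signed_graph m :=
  SignedGraph (delete_sym F) (delete_diag F) (delete_sign F).

End SignedGraph.

Definition frustration_index (m : nat) (S : signed_graph m) : nat :=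
  #|[arg min_(F < sedges S |
        (F \subset sedges S) && balanced (delete_edges S F)) #|F|]|.

Lemma delete_all_balanced (m : nat) (S : signed_graph m) :
  balanced (delete_edges S (sedges S)).
Proof.
apply/balancedP => -[|i [|j c]] //= /and3P[_ _ /= /andP[]].
rewrite mxE; case: ifP; rewrite ?eqxx // inE => /negbT/negP nij Sij.
by case: nij; apply/existsP; exists i; apply/existsP; exists j; rewrite Sij /=.
Qed.

Lemma frustration_indexP (m : nat) (S : signed_graph m) :
  (exists F : {set {set 'I_m}},
     [/\ F \subset sedges S, balanced (delete_edges S F)
       & #|F| = frustration_index S]) /\
  (forall F : {set {set 'I_m}},
     F \subset sedges S -> balanced (delete_edges S F) ->
     (frustration_index S <= #|F|)%N).
Proof.
rewrite /frustration_index; case: arg_minnP => [|F /andP[FS Fb] Fmin].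
  by rewrite subxx delete_all_balanced.
split; first by exists F.
by move=> F' F'S F'b; apply: Fmin; rewrite F'S.
Qed.

Section AntisymmetricLineGraph.
Variables (G : sgraph) (o : orientation G).

Let D : 'M[int]_(#|G|, #|edge G|) := incidence_mx int o.

Definition aline_mx : 'M[int]_#|edge G| := D^T *m D - 2%:M.

Lemma head_neq_tail e : head o e != tail o e.
Proof.
have := valP e; rewrite inE => /existsP[x /existsP[y /andP[xy /eqP Exy]]].
apply/eqP => ht; have := head_tail o e; rewrite Exy ht setUid => /setP s1.
have:= s1 x; have := s1 y; rewrite !inE !eqxx orbT => /esym/eqP yt /esym/eqP xt.
by rewrite yt xt adj_irr in xy.
Qed.

Lemma incidence_neq0 v e : (D v e != 0) = (enum_val v \in val (enum_val e)).
Proof.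
by rewrite mxE (head_tail o) !inE; case: ifP => //= _; case: ifP.
Qed.

Lemma incidence_sign v e : D v e \in [:: -1; 0; 1].
Proof. by rewrite mxE; case: ifP => //= _; case: ifP. Qed.

Fact aline_sym : aline_mx^T = aline_mx.
Proof. by rewrite /aline_mx linearB /= trmx_mul trmxK tr_scalar_mx. Qed.

Fact aline_diag e : aline_mx e e = 0.
Proof.
rewrite !mxE eqxx mulr1n.
pose h := enum_rank (head o (enum_val e)); pose t := enum_rank (tail o (enum_val e)).
have th : t != h by rewrite (inj_eq enum_rank_inj) eq_sym head_neq_tail.
rewrite (bigD1 h) //= (bigD1 t) //= big1 => [|v /andP[vh vt]].
  rewrite !mxE !enum_rankK !eqxx.
  by rewrite eq_sym (negPf (head_neq_tail _)).
rewrite !mxE !(can2_eq enum_valK enum_rankK).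
by rewrite (negPf vh) (negPf vt) mulr0.
Qed.

Fact aline_sign e f : aline_mx e f \in [:: -1; 0; 1].
Proof.
have [<-|nef] := eqVneq e f; first by rewrite aline_diag.
rewrite !mxE (negPf nef) mulr0n subr0.
have [v /andP[ve vf]|none] := pickP (fun v => (D v e != 0) && (D v f != 0)).
  rewrite (bigD1 v) //= big1 ?addr0 => [|u uv].
    rewrite mxE; move: (incidence_sign v e) (incidence_sign v f).
    by rewrite !inE => /or3P[]/eqP-> /or3P[]/eqP->.
  rewrite mxE; apply/eqP; rewrite mulf_eq0; apply: contraT.
  rewrite negb_or !incidence_neq0 => /andP[ue uf].
  move: ve vf; rewrite !incidence_neq0 => ve vf.
  case/negP: nef; apply/eqP/enum_val_inj/val_inj.
  have E (g : edge G) : enum_val v \in val g -> enum_val u \in val g ->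
      val g = [set enum_val u; enum_val v].
    move=> vg ug; apply/esym/eqP; rewrite eqEcard.
    rewrite {2}(head_tail o) !cards2 (inj_eq enum_val_inj) uv head_neq_tail.
    by rewrite leqnn andbT; apply/subsetP => w; rewrite !inE => /orP[]/eqP->.
  by rewrite (E _ ve ue) (E _ vf uf).
rewrite big1 // => v _; apply/eqP; rewrite mxE mulf_eq0.
by apply: contraFT (none v); rewrite negb_or.
Qed.

Definition antisym_line_graph : signed_graph #|edge G| :=
  SignedGraph aline_sym aline_diag aline_sign.

End AntisymmetricLineGraph.

Section MaxSqNorm.
Variable R : rcfType.

Definition enorm n (x : 'cV[R]_n) : R := Num.sqrt (\sum_i x i 0 ^+ 2).

(* The elements of {-1, 1}^n, encoded by finite boolean functions;
   see sign_vecP. *)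
Definition sign_vec n (s : {ffun 'I_n -> bool}) : 'cV[R]_n :=
  \col_i (-1) ^+ s i.

Lemma sign_vecP n (x : 'cV[R]_n) :
  (forall i, x i 0 = 1 \/ x i 0 = -1) <-> exists s, x = sign_vec s.
Proof.
split=> [xP | [s -> i]]; last by rewrite mxE; case: (s i); [right|left].
have N11 : (-1 == 1 :> R) = false.
  by rewrite eq_sym -subr_eq0 opprK -[1 + 1]/(2%:R) pnatr_eq0.
exists [ffun i => x i 0 != 1]; apply/matrixP => i j; rewrite ord1 mxE ffunE.
by case: (xP i) => ->; rewrite ?eqxx ?N11.
Qed.

(* The default value 0 is harmless: the range is nonempty and the terms are
   nonnegative; see max_sqnormP. *)
Definition max_sqnorm m n (A : 'M[R]_(m, n)) : R :=
  \big[Num.max/0]_(s : {ffun 'I_n -> bool}) enorm (A *m sign_vec s) ^+ 2.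

Lemma max_sqnormP m n (A : 'M[R]_(m, n)) :
  (exists s, max_sqnorm A = enorm (A *m sign_vec s) ^+ 2) /\
  (forall s, enorm (A *m sign_vec s) ^+ 2 <= max_sqnorm A).
Proof.
pose f s := enorm (A *m sign_vec s) ^+ 2.
split; last by move=> s; rewrite /max_sqnorm (bigmax_sup s).
exists [arg max_(s > [ffun=> false]) f s]%O.
by apply: (@bigmax_eq_arg _ _ _ 0 _ xpredT f) => // s _; apply: sqr_ge0.
Qed.

End MaxSqNorm.

(* Main.v *)
(** By Harary's theorem a signed graph is balanced iff some switching makes all
    its edges positive, so the frustration index is the least number of negative
    edges over all switchings [s].  For the line graph with adjacency matrix
    [D^T D - 2 I], the switched entries add up to [||Ds||^2 - 2|E|] and their
    absolute values to [\sum_v d(v)^2 - 2|E|], because two distinct edges share at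
    most one vertex and nothing cancels in [D^T D] off the diagonal.  The
    difference of these two sums counts each negative edge four times: the
    difference is 2 on a negative entry, and each edge gives two entries. *)
Require Import Defs.
From mathcomp Require Import all_boot all_order all_algebra.
From mathcomp Require Import zify.
Import Order.TTheory GRing.Theory Num.Theory.
Local Open Scope ring_scope.

(** * Sequences and unordered pairs *)

(** Used to cut a walk at two visits of [y]: the block [rcons p2 y] is then a closed walk at [y]. *)
Lemma not_uniq_split (T : eqType) (p : seq T) :
  ~~ uniq p -> exists y p1 p2 p3, p = rcons p1 y ++ rcons p2 y ++ p3.
Proof.
elim: p => //= x p IHp; rewrite negb_and negbK => /orP[|/IHp].
  by case/path.splitP=> p1 p2; exists x, [::], p1, p2.
by case=> y [p1 [p2 [p3 ->]]]; exists y, (x :: p1), p2, p3.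
Qed.

Lemma set2_eq (T : finType) (i j a b : T) :
  [set i; j] = [set a; b] -> (i, j) = (a, b) \/ (i, j) = (b, a).
Proof.
move=> Eij; have /set2P iab : i \in [set a; b] by rewrite -Eij set21.
have /set2P jab : j \in [set a; b] by rewrite -Eij set22.
have /set2P aij : a \in [set i; j] by rewrite Eij set21.
have /set2P bij : b \in [set i; j] by rewrite Eij set22.
by case: iab aij bij => ->; case: jab => ->; intuition (subst; auto).
Qed.

(** * Signs of walks in a signed graph *)

Section Harary.
Context {m : nat} (S : signed_graph m).

Definition linked (i j : 'I_m) : bool := sadj S i j != 0.

(** Follows the convention of [path]: the start [x] is not listed in [p]. *)
Definition walk_sign (x : 'I_m) (p : seq 'I_m) : int :=
  \prod_(a <- pairmap (sadj S) x p) a.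

Lemma sadjC i j : sadj S i j = sadj S j i.
Proof. by rewrite -[in LHS](sadj_sym S) mxE. Qed.

Lemma linkedC : symmetric linked.
Proof. by move=> i j; rewrite /linked sadjC. Qed.

Lemma sadj_sqr i j : linked i j -> sadj S i j ^+ 2 = 1.
Proof.
rewrite /linked; have := sadj_sign S i j.
by rewrite !inE => /or3P[]/eqP->.
Qed.

Lemma walk_sign_cat x p q :
  walk_sign x (p ++ q) = walk_sign x p * walk_sign (last x p) q.
Proof. by rewrite /walk_sign pairmap_cat big_cat. Qed.

Lemma walk_sign_sqr x p : path linked x p -> walk_sign x p ^+ 2 = 1.
Proof.
elim: p x => [|y p IHp] x /=; first by rewrite /walk_sign big_nil expr1n.
by case/andP=> xy /IHp; rewrite /walk_sign /= big_cons exprMn sadj_sqr // mul1r.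
Qed.

Lemma cycle_sign_walk x p :
  uniq (x :: p) -> cycle_sign S (x :: p) = walk_sign x (rcons p x).
Proof.
move=> uxp; rewrite /cycle_sign /walk_sign.
rewrite (big_nth x) [RHS](big_nth 0) size_pairmap size_rcons.
rewrite !big_mkord; apply: eq_bigr => i _.
rewrite (nth_pairmap x) ?size_rcons //; congr (sadj S _ _).
  by rewrite -rcons_cons nth_rcons /= ltn_ord.
(* At the last vertex [next] falls back on the default of [nth], here [x], which is the vertex that
   closes the walk. *)
rewrite next_nth mem_nth // index_uniq // nth_rcons.
by case: ltnP => // p_i; rewrite nth_default // if_same.
Qed.

(* A closed walk that repeats a vertex splits there into two shorter ones. *)
Lemma balanced_closed_walk x p :
  balanced S -> path linked x p -> last x p = x -> walk_sign x p = 1.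
Proof.
move/balancedP=> bal.
have [n] := ubnP (size p); elim: n x p => // n IHn x p; rewrite ltnS => le_n.
have [up|/not_uniq_split] := boolP (uniq p); last first.
  move=> [y [p1 [p2 [p3 Ep]]]]; move: le_n.
  rewrite {p}Ep !size_cat !size_rcons => le_n.
  rewrite !cat_path !last_cat !last_rcons => /and3P[P1 P2 P3] lx.
  (* The middle factor is a closed walk at [y]; the outer two join into a closed walk at [x]. *)
  rewrite !walk_sign_cat !last_rcons mulrCA (IHn y) ?last_rcons //; last first.
    by rewrite size_rcons; lia.
  have:= IHn x (rcons p1 y ++ p3).
  rewrite mul1r walk_sign_cat cat_path last_cat !last_rcons P1; apply => //.
  by rewrite size_cat size_rcons; lia.
case/lastP: p up le_n => [|p z] up _ P lx; first by rewrite /walk_sign big_nil.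
rewrite last_rcons in lx; rewrite {z}lx in up P *.
have uxp : uniq (x :: p) by rewrite rcons_uniq in up.
(* With at most two vertices the walk is a loop, excluded by the zero diagonal, or one edge run back
   and forth, whose sign is a square. Otherwise it is a cycle. *)
have [le2|lt2] := leqP (size (x :: p)) 2.
  case: p {up uxp} P le2 => [|y [|]] //=.
    by rewrite /linked sadj_diag eqxx.
  case/and3P=> xy _ _ _; rewrite /walk_sign !big_cons big_nil mulr1.
  by rewrite [sadj S y x]sadjC -expr2 sadj_sqr.
by rewrite -cycle_sign_walk // bal // /is_cycle lt2 uxp.
Qed.

(** * Switchings and Harary's theorem *)

Definition switching (s : {ffun 'I_m -> bool}) (i j : 'I_m) : int :=
  (-1) ^+ s i * sadj S i j * (-1) ^+ s j.

Lemma switchingC s i j : switching s i j = switching s j i.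
Proof. by rewrite /switching sadjC mulrC [(-1) ^+ s i * _]mulrC mulrA. Qed.

Lemma switching_val s i j :
  [\/ switching s i j = -1, switching s i j = 0 | switching s i j = 1].
Proof.
have: switching s i j \in [:: -1; 0; 1].
  have := sadj_sign S i j; rewrite /switching !inE.
  by case: (s i) (s j) => -[] /or3P[]/eqP->.
by rewrite !inE => /or3P[]/eqP->; [apply: Or31|apply: Or32|apply: Or33].
Qed.

(** Around a cycle [sadj S i j] is the product of the switching signs of its ends. Since [next]
    permutes the vertices of the cycle, each vertex sign occurs twice and the product is 1. *)
Lemma switching_balanced s :
  (forall i j, linked i j -> switching s i j = 1) -> balanced S.
Proof.
move=> sP; apply/balancedP=> c /and3P[_ uc cc].
rewrite /cycle_sign (eq_big_seq (fun i => (-1) ^+ s i * (-1) ^+ s (next c i))).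
  rewrite big_split /=.
  rewrite -[X in _ * X](big_map (next c) xpredT (fun j => (-1) ^+ s j)).
  rewrite [X in _ * X](perm_big c) /=; last first.
    apply: uniq_perm => //.
      by rewrite (map_inj_uniq (can_inj (prev_next uc))).
    move=> j; apply/mapP/idP=> [[i ci ->]|cj]; first by rewrite mem_next.
    by exists (prev c j); rewrite ?mem_prev ?next_prev.
  rewrite -big_split big1 //= => i _; by rewrite -expr2 sqrr_sign.
move=> i ci; have := sP _ _ (next_cycle cc ci); rewrite /switching.
by case: (s i); case: (s _);
  rewrite ?(expr0, expr1, mulr1, mul1r, mulrN1, mulN1r, opprK) // => <-;
  rewrite opprK.
Qed.

(** Give each vertex the sign of a chosen walk from the root of its component. Closed walks are
    positive, so this sign does not depend on the walk, and following an edge multiplies it by the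
    sign of that edge. *)
Lemma balanced_switching :
  balanced S -> exists s, forall i j, linked i j -> switching s i j = 1.
Proof.
move=> bal; have csym := sym_connect_sym linkedC.
have /fin_all_exists[s sP] i : exists b : bool, exists p,
    let x := fingraph.root linked i in
    [/\ path linked x p, last x p = i & walk_sign x p = (-1) ^+ b].
  have: connect linked (fingraph.root linked i) i.
    by rewrite csym connect_root.
  case/connectP=> p Pp lp; have /eqP := walk_sign_sqr _ _ Pp.
  rewrite sqrf_eq1 => /orP[]/eqP wp; first by exists false, p.
  by exists true, p.
exists [ffun i => s i] => i j ij; rewrite /switching !ffunE.
have rij : fingraph.root linked i = fingraph.root linked j.
  exact/(fingraph.rootP csym)/connect1.
have [p [Pp lp <-]] := sP i; have [q [Pq lq <-]] := sP j.
(* The return walk [r] closes up both [q] and [p] followed by the edge from [i] to [j]; comparing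
   the two positive signs eliminates [r]. *)
have [r Pr lr] := connectP (connect_root linked j).
rewrite -{}rij in Pq lq lr *; set x := fingraph.root _ _ in Pp lp Pq lq lr *.
have wqr : walk_sign x (q ++ r) = 1.
  by apply: balanced_closed_walk; rewrite // ?cat_path ?last_cat ?Pq lq.
have wpr : walk_sign x (p ++ j :: r) = 1.
  apply: balanced_closed_walk; rewrite // ?cat_path ?last_cat ?Pp lp //=.
  by apply/andP.
move: wpr wqr; rewrite !walk_sign_cat lp lq.
rewrite {2}/walk_sign /= big_cons -/(walk_sign _ _) => wpr wqr.
have wr : walk_sign j r = walk_sign x q.
  by rewrite -[RHS]mulr1 -wqr mulrA -expr2 (walk_sign_sqr _ _ Pq) mul1r.
by rewrite -wr -mulrA.
Qed.

(** * Counting negative edges of a switching *)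

Definition negative_edges (s : {ffun 'I_m -> bool}) : {set {set 'I_m}} :=
  [set [set p.1; p.2] | p in [pred p : 'I_m * 'I_m | switching s p.1 p.2 == -1]].

Lemma negative_edgesP s i j :
  ([set i; j] \in negative_edges s) = (switching s i j == -1).
Proof.
apply/imsetP/idP=> [[[a b]]|neg_ij]; last by exists (i, j).
by rewrite inE /= => neg_ab /set2_eq[][-> ->] //; rewrite switchingC.
Qed.

Lemma switching_diag s i : switching s i i = 0.
Proof. by rewrite /switching sadj_diag mulr0 mul0r. Qed.

Lemma switching_neq0 s i j : (switching s i j != 0) = linked i j.
Proof. by rewrite /switching !mulf_eq0 !signr_eq0 /= orbF. Qed.

Lemma negative_edges_sub s : negative_edges s \subset sedges S.
Proof.
apply/subsetP=> A /imsetP[[i j] /eqP neg_ij ->]; rewrite inE.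
apply/existsP; exists i; apply/existsP; exists j.
by rewrite eqxx andbT -[_ != 0](switching_neq0 s) neg_ij.
Qed.

(** The zero diagonal forces [i != j], so each negative edge comes from exactly two ordered
    pairs. *)
Lemma card_negative_edges s :
  (2 * #|negative_edges s|)%N = #|[pred p | switching s p.1 p.2 == -1]|.
Proof.
rewrite -[RHS]sum1_card (partition_big_imset (fun p => [set p.1; p.2])) /=.
rewrite mulnC -sum_nat_const; apply: eq_bigr => A /imsetP[[i j] /= neg_ij ->].
have nij : i != j.
  by apply: contraTneq neg_ij => ->; rewrite inE /= switching_diag.
have -> : 2%N = #|[set (i, j); (j, i)]|.
  by rewrite cards2 xpair_eqE negb_and nij.
rewrite -sum1_card; apply: eq_bigl => -[a b]; rewrite [in RHS]inE /=.
rewrite inE /= in neg_ij; apply/set2P/andP=> [[][-> ->]|[_ /eqP/set2_eq[]->]].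
- by rewrite neg_ij eqxx.
- by rewrite switchingC neg_ij setUC eqxx.
- by left.
- by right.
Qed.

Lemma sum_switching s :
  \sum_i \sum_j `|sadj S i j| - \sum_i \sum_j switching s i j
  = (4 * #|negative_edges s|)%:R.
Proof.
(* One factor 2 counts the two orders of an edge; the other is the value of |a| - a at a = -1. *)
rewrite -[4%N]/(2 * 2)%N -mulnA card_negative_edges -sum1_card natrM natr_sum.
rewrite mulr_sumr [RHS]big_mkcond !pair_bigA -sumrB /=.
apply: eq_bigr => -[i j] _; rewrite inE /=.
have -> : `|sadj S i j| = `|switching s i j|.
  by rewrite /switching !normrM !normr_sign mul1r mulr1.
by case: (switching_val s i j) => ->.
Qed.

End Harary.

(** * The frustration index as a minimum over switchings *)

Section FrustrationSwitching.
Context {m : nat} (S : signed_graph m).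

Lemma negative_edges_balanced s :
  balanced (delete_edges S (negative_edges S s)).
Proof.
apply: (@switching_balanced _ _ s) => i j; rewrite /linked /switching /= mxE.
rewrite negative_edgesP; case: ifP => //=.
rewrite -[sadj S i j != 0]/(linked S i j).
rewrite -(switching_neq0 S s) -/(switching S s i j).
by case: (switching_val S s i j) => ->.
Qed.

(** Harary's theorem makes all surviving edges positive under some [s], so an edge negative under
    [s] must have been deleted. *)
Lemma balanced_negative_edges F :
  balanced (delete_edges S F) -> exists s, negative_edges S s \subset F.
Proof.
case/balanced_switching=> s sP; exists s; apply/subsetP=> A.
case/imsetP=> -[i j]; rewrite inE /= => neg_ij ->.
apply: contraTT neg_ij => ijF; have := sP i j.
rewrite /linked /switching /= mxE (negPf ijF) => sij.
have [/eqP|nz] := boolP (sadj S i j == 0).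
  by rewrite /switching => ->; rewrite mulr0 mul0r.
by rewrite /switching sij.
Qed.

Lemma frustration_index_switching :
  (exists s, frustration_index S = #|negative_edges S s|) /\
  (forall s, (frustration_index S <= #|negative_edges S s|)%N).
Proof.
have [[F [FS Fb FE]] Fmin] := frustration_indexP S.
have Fle s : (frustration_index S <= #|negative_edges S s|)%N.
  exact: Fmin (negative_edges_sub S s) (negative_edges_balanced s).
(* An optimal [F] contains the negative edges of some [s]; deleting these already gives balance, so
   the cardinals agree. *)
have [s sF] := balanced_negative_edges _ Fb.
by split=> //; exists s; apply/eqP; rewrite eqn_leq Fle -FE subset_leq_card.
Qed.

End FrustrationSwitching.

(** * Entry sums for the antisymmetric line graph *)

Section LineGraph.
Context (G : sgraph) (o : orientation G).
Let D : 'M[int]_(#|G|, #|edge G|) := incidence_mx int o.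

Lemma norm_incidence v e : `|D v e| = (enum_val v \in val (enum_val e))%:R.
Proof.
rewrite -(incidence_neq0 o); have := incidence_sign o v e.
by rewrite !inE -/D => /or3P[]/eqP->.
Qed.

(** The map sending [u] to [[set v; u]] is a bijection from the neighbours of [v] to the edges
    containing [v]. *)
Lemma sum_norm_incidence v : \sum_e `|D v e| = (degree (enum_val v))%:R.
Proof.
under eq_bigr do rewrite norm_incidence.
rewrite -(big_enum_val (fun e : edge G => (enum_val v \in val e)%:R)) /=.
move: (enum_val v) => {}v.
rewrite -natr_sum -big_mkcond sum1dep_card; congr _%:R.
rewrite -(card_imset _ val_inj) /degree.
rewrite -(card_in_imset (f := fun u => [set v; u])); last first.
  by move=> u w _ _ /set2_eq[][] // -> <-.
apply: eq_card => A; apply/imsetP/imsetP=> [[e]|[u]]; rewrite inE.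
  move=> ve ->; have := valP e; rewrite inE.
  case/existsP=> x /existsP[y /andP[xy /eqP Ee]].
  rewrite Ee; have /set2P : v \in [set x; y] by rewrite -Ee.
  case=> ->; first by exists y; rewrite ?inE.
  by exists x; rewrite ?inE 1?adj_sym // setUC.
move=> vu ->; have vuE : [set v; u] \in edges G.
  rewrite inE; apply/existsP; exists v; apply/existsP; exists u.
  by rewrite vu /=.
by exists (exist (fun A => A \in edges G) _ vuE); rewrite ?inE /= ?inE ?eqxx.
Qed.

Lemma aline_mxE i j :
  aline_mx o i j = \sum_v D v i * D v j - 2 * (i == j)%:R.
Proof.
rewrite 4!mxE -/D mulr_natr; congr (_ - _).
by apply: eq_bigr => v _; rewrite mxE.
Qed.

(** The absolute value passes through the sum over [v]: on the diagonal the terms are squares, and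
    off it at most one term is nonzero. *)
Lemma norm_aline i j :
  `|aline_mx o i j| = \sum_v `|D v i| * `|D v j| - 2 * (i == j)%:R.
Proof.
have [<-|nij] := eqVneq i j.
  rewrite aline_diag normr0 -[LHS](aline_diag o i) aline_mxE eqxx.
  congr (_ - _); apply: eq_bigr => v _.
  by rewrite -normrM -expr2 ger0_norm ?sqr_ge0.
rewrite aline_mxE (negPf nij) mulr0 !subr0.
have [v /andP[vi vj]|none] := pickP (fun v => (D v i != 0) && (D v j != 0)).
  have vun u : u != v -> D u i * D u j = 0.
    move=> uv; apply/eqP; rewrite mulf_eq0; apply: contraNT nij.
    rewrite negb_or; move: vi vj; rewrite !incidence_neq0 => vi vj /andP[ui uj].
    (* Two distinct common vertices would exhaust both edges and make them equal. *)
    have E (e : edge G) :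
        enum_val v \in val e -> enum_val u \in val e ->
        val e = [set enum_val u; enum_val v].
      move=> ve ue; apply/eqP; rewrite eq_sym eqEcard subUset !sub1set ue ve /=.
      by rewrite (head_tail o) !cards2 (inj_eq enum_val_inj) uv head_neq_tail.
    by apply/eqP/enum_val_inj/val_inj; rewrite (E _ vi ui) (E _ vj uj).
  rewrite (bigD1 v) //= [RHS](bigD1 v) //= !big1 ?addr0 => [|u /vun uv|u /vun uv].
  - by rewrite normrM.
  - by rewrite -normrM uv normr0.
  - by [].
have zero v : D v i * D v j = 0.
  by apply/eqP; rewrite mulf_eq0; apply: contraFT (none v); rewrite negb_or.
by rewrite !big1 ?normr0 // => v _; rewrite -normrM zero normr0.
Qed.

(** For each vertex the sum over pairs of edges factors as the square of its row sum of absolute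
    values, which is the degree. *)
Lemma sum_norm_aline :
  \sum_i \sum_j `|aline_mx o i j| =
  \sum_(v : G) (degree v)%:R ^+ 2 - 2 * #|edge G|%:R.
Proof.
under eq_bigr do under eq_bigr do rewrite norm_aline.
under eq_bigr do rewrite sumrB -mulr_sumr.
rewrite sumrB -mulr_sumr; congr (_ - _ * _); last first.
  rewrite (eq_bigr (fun=> 1)) ?sumr_const ?card_ord // => i _.
  rewrite (bigD1 i) //= big1 ?eqxx ?addr0 // => j /negPf.
  by rewrite eq_sym => ->.
rewrite (big_enum_val (fun v : G => (degree v)%:R ^+ 2)) /=.
under [RHS]eq_bigr do rewrite -sum_norm_incidence expr2 mulr_suml.
rewrite [RHS]exchange_big; apply: eq_bigr => i _.
by rewrite exchange_big; apply: eq_bigr => v _; rewrite mulr_sumr.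
Qed.

(** This is the quadratic form of D^T D - 2I at the sign vector x of [s], where x^T x = |E|. *)
Lemma sum_switching_aline s :
  \sum_i \sum_j switching (antisym_line_graph o) s i j =
  \sum_v (\sum_e D v e * (-1) ^+ s e) ^+ 2 - 2 * #|edge G|%:R.
Proof.
under [X in _ = X - _]eq_bigr do rewrite expr2 mulr_suml.
(* Spread as 2 per row, the constant cancels the diagonal terms of D^T D. *)
have -> : 2 * #|edge G|%:R = \sum_(i < #|edge G|) 2 :> int.
  by rewrite sumr_const card_ord mulr_natr.
rewrite [X in _ = X - _]exchange_big /= -sumrB.
apply: eq_bigr => i _; under [X in _ = X - _]eq_bigr do rewrite mulr_sumr.
rewrite [X in _ = X - _]exchange_big /= (bigD1 i) //= [in RHS](bigD1 i) //=.
rewrite addrAC; congr (_ + _); last first.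
  apply: eq_bigr => j /negPf; rewrite eq_sym /switching /= => nij.
  rewrite aline_mxE nij mulr0 subr0 mulr_sumr mulr_suml.
  apply: eq_bigr => v _.
  by rewrite !mulrA [_ * D v i]mulrC.
rewrite switching_diag -[LHS](aline_diag o i) aline_mxE eqxx mulr1.
congr (_ - _).
by apply: eq_bigr => v _; rewrite mulrACA -[(-1) ^+ _ * _]expr2 sqrr_sign mulr1.
Qed.

Lemma negative_edges_aline s :
  (4 * #|negative_edges (antisym_line_graph o) s|)%:R =
  \sum_(v : G) (degree v)%:R ^+ 2 - \sum_v (\sum_e D v e * (-1) ^+ s e) ^+ 2.
Proof.
rewrite -sum_switching sum_switching_aline sum_norm_aline.
by rewrite opprB addrA subrK.
Qed.

(** The integer identity [negative_edges_aline], carried to [R] by the ring morphism [intr] and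
    solved for the squared norm. *)
Lemma enorm_incidence (R : rcfType) s :
  enorm (incidence_mx R o *m sign_vec R s) ^+ 2 =
  \sum_(v : G) (degree v)%:R ^+ 2
  - 4 * #|negative_edges (antisym_line_graph o) s|%:R.
Proof.
have degE : (\sum_(v : G) (degree v)%:R ^+ 2 : int)%:~R =
    \sum_(v : G) (degree v)%:R ^+ 2 :> R.
  by rewrite rmorph_sum; apply: eq_bigr => v _; rewrite rmorphXn /= rmorph_nat.
have := congr1 (intr : int -> R) (negative_edges_aline s).
rewrite -[4 * _]natrM rmorphB /= degE rmorph_sum /= rmorph_nat => ->.
rewrite sqr_sqrtr; last by apply: sumr_ge0 => v _; apply: sqr_ge0.
rewrite opprB addrCA subrr addr0; apply: eq_bigr => v _.
rewrite rmorphXn rmorph_sum /= mxE; congr (_ ^+ 2); apply: eq_bigr => e _.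
rewrite rmorphM rmorph_sign !mxE; congr (_ * _).
by case: ifP => _ //; case: ifP => _; rewrite ?rmorphN1.
Qed.

End LineGraph.

(** * From fewest negative edges to the largest norm *)

Theorem proposition8 (R : rcfType) (G : sgraph) (o : orientation G) :
  (frustration_index (antisym_line_graph o))%:R =
    4^-1 * (\sum_(v : G) (degree v)%:R ^+ 2)
    - 4^-1 * max_sqnorm (incidence_mx R o) :> R.
Proof.
set S := antisym_line_graph o.
have [[s0 s0P] s0min] := frustration_index_switching S.
have [[s1 s1P] s1max] := max_sqnormP (incidence_mx R o).
(* The squared norm decreases as negative edges increase. The maximiser [s1] has at least
   [frustration_index S] negative edges, which gives one inequality; the minimiser [s0] competes in
   the maximum, which gives the other. *)
have /eqP : max_sqnorm (incidence_mx R o) =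
    \sum_(v : G) (degree v)%:R ^+ 2 - 4 * (frustration_index S)%:R.
  apply/eqP; rewrite eq_le; apply/andP; split.
    by rewrite s1P enorm_incidence lerD2l lerN2 ler_pM2l ?ler_nat ?ltr0n.
  by rewrite s0P -enorm_incidence.
move/eqP=> ->; rewrite mulrBr opprB addrCA subrr addr0 mulKf //.
by rewrite pnatr_eq0.
Qed.
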